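(* For $3\times 3$ partial Hankel matrices $H_2$, none of the patterns $\{0,1,3,4\}$, $\{0,1,4\}$, $\{0,3,4\}$ is positive definite completable.
   Context: A $3\times 3$ partial Hankel matrix is $H_2=[s_{i+j}]_{i,j=0}^{2}$ where some of the real entries $s_0,s_1,s_2,s_3,s_4$ are specified and the others are unspecified. Its pattern is $P=\{k\in\{0,1,2,3,4\} : s_k\text{ is specified}\}$. It is partial positive definite if each of its fully specified principal submatrices is positive definite. A positive definite completion is a choice of real values for the unspecified $s_k$ resulting in a positive definite Hankel matrix. A pattern $P$ of $H_2$ is positive definite completable if every partial positive definite $3\times 3$ Hankel matrix with pattern $P$ has a positive definite completion. *)

(* Defs.v *)
From mathcomp Require Import all_boot all_order all_algebra.
From mathcomp Require Import reals.

Set Implicit Arguments.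
Unset Strict Implicit.
Unset Printing Implicit Defensive.

Import Order.TTheory GRing.Theory Num.Theory.
Local Open Scope ring_scope.

Definition hankel (T : Type) (s : 'I_5 -> T) : 'M[T]_3 :=
  \matrix_(i < 3, j < 3) s (inord (i + j)%N).

Definition principal_submx (T : Type) (n : nat) (I : {set 'I_n})
    (A : 'M[T]_n) : 'M[T]_#|I| :=
  mxsub (@enum_val _ (mem I)) (@enum_val _ (mem I)) A.

Definition posdefmx (R : realType) (n : nat) (A : 'M[R]_n) : Prop :=
  A^T = A /\ forall u : 'rV[R]_n, u != 0 -> 0 < (u *m A *m u^T) 0 0.

(* A partial Hankel matrix is [hankel s] with [s : 'I_5 -> option R], where
   [None] marks an unspecified entry. *)

Definition pattern (R : realType) (s : 'I_5 -> option R) : {set 'I_5} :=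
  [set k | s k != None].

(* A submatrix is fully specified, with real entries [A], when it has the form
   [map_mx Some A]. The case [I = set0] is harmless: every 0 x 0 matrix is
   [posdefmx]. *)
Definition partial_posdefmx (R : realType) (n : nat) (H : 'M[option R]_n) : Prop :=
  forall (I : {set 'I_n}) (A : 'M[R]_#|I|),
    principal_submx I H = map_mx Some A -> posdefmx A.

Definition posdef_completion (R : realType) (s : 'I_5 -> option R)
    (t : 'I_5 -> R) : Prop :=
  (forall k a, s k = Some a -> t k = a) /\ posdefmx (hankel t).

Definition posdef_completable (R : realType) (P : {set 'I_5}) : Prop :=
  forall s : 'I_5 -> option R,
    pattern s = P -> partial_posdefmx (hankel s) ->
    exists t : 'I_5 -> R, posdef_completion s t.

(* Main.v *)
Require Import Defs.
From mathcomp Require Import all_boot all_order all_algebra.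
From mathcomp Require Import reals.
From mathcomp Require Import lra.

(** Fill a pattern containing 0 and 4, not 2, and at least one of 1 and 3 by
    [s_0 = s_4 = 1] and [s_1 = s_3 = 2]. As [s_2] is unspecified, the only
    nonempty fully specified principal submatrices are [s_0] and [s_4], so the
    data are partial positive definite. In a positive definite completion,
    testing on (1, 0, -1) gives [s_2 < 1], whereas testing on (1, -1, 0) or
    (0, -1, 1) gives [3 < s_2]. *)

Set Implicit Arguments.
Unset Strict Implicit.
Unset Printing Implicit Defensive.

Import Order.TTheory GRing.Theory Num.Theory.
Local Open Scope ring_scope.

Lemma posdefmx1 (R : realType) (n : nat) : posdefmx (1%:M : 'M[R]_n).
Proof.
split=> [|u u_neq0]; first exact: trmx1.
rewrite mulmx1 mxE lt0r; apply/andP; split; last first.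
  by apply: sumr_ge0 => i _; rewrite mxE -expr2 sqr_ge0.
apply: contra_neq u_neq0 => uu0; apply/rowP=> i; rewrite mxE.
have /psumr_eq0P : forall j, true -> 0 <= u 0 j * u^T j 0.
  by move=> j _; rewrite mxE -expr2 sqr_ge0.
move=> /(_ uu0 i isT) /eqP; rewrite mxE -expr2 sqrf_eq0.
by move/eqP.
Qed.

(** Grouping by antidiagonals, the coefficient of [t (inord k)] is that of [X^k] in the square of
    [x + y X + z X^2]. *)
Lemma posdefmx_hankel_form (R : realType) (t : 'I_5 -> R) (x y z : R) :
  posdefmx (hankel t) -> [|| x != 0, y != 0 | z != 0] ->
  0 < x ^+ 2 * t (inord 0) + 2 * x * y * t (inord 1)
      + (2 * x * z + y ^+ 2) * t (inord 2) + 2 * y * z * t (inord 3)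
      + z ^+ 2 * t (inord 4).
Proof.
move=> [_ pd] nz; pose u := \row_(i < 3) nth 0 [:: x; y; z] i.
have u_neq0 : u != 0.
  apply: contraL nz => /eqP/rowP u0; rewrite !negb_or !negbK.
  have := u0 ord_max; have := u0 1; have := u0 0.
  by rewrite !mxE /= => -> -> ->; rewrite !eqxx.
have := pd u u_neq0; rewrite !(mxE, big_ord_recr, big_ord0) /=.
by move=> h; lra.
Qed.

(** With ends 1 and [s_1 = a] or [s_3 = a], the tests demand [s_2 < 1] and [2a - 1 < s_2], which
    clash once [a >= 1]; here [a = 2]. *)
Definition counterexample (R : realType) (P : {set 'I_5}) (k : 'I_5) : option R :=
  if k \in P then Some (if (k == inord 0) || (k == inord 4) then 1 else 2)
  else None.

Lemma pattern_counterexample (R : realType) (P : {set 'I_5}) :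
  pattern (counterexample R P) = P.
Proof. by apply/setP=> k; rewrite inE /counterexample; case: (k \in P). Qed.

(** Since [s_2] sits at (1,1), (0,2) and (2,0), the set [I] contains neither 1 nor both 0 and 2. So
    [A] is empty or the 1 x 1 matrix with entry 1. *)
Lemma partial_posdefmx_counterexample (R : realType) (P : {set 'I_5}) :
  inord 2 \notin P -> partial_posdefmx (hankel (counterexample R P)).
Proof.
move=> P2 I A IA; suff -> : A = 1%:M by exact: posdefmx1.
pose f := @enum_val _ (mem I).
have AE i j : counterexample R P (inord (f i + f j)) = Some (A i j).
  by move/matrixP/(_ i j): IA; rewrite !mxE.
have sum_neq2 i j : (f i + f j)%N != 2.
  by apply/eqP=> ij2; have := AE i j; rewrite ij2 /counterexample (negbTE P2).
apply/matrixP=> i j; rewrite mxE.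
have := (sum_neq2 i i, sum_neq2 j j, sum_neq2 i j); have := AE i j.
(* Injectivity turns [i == j] into equality of indices in ['I_3], leaving nine concrete cases; only
   (0,0) and (2,2) avoid the sum 2. *)
rewrite -(inj_eq (@enum_val_inj _ (mem I))) -/(f i) -/(f j) -val_eqE /=.
rewrite /counterexample; case: ifP => // _ [<-].
by case: (f i) (f j) => [[|[|[|//]]] /= _] [[|[|[|//]]] /= _];
  rewrite -?val_eqE /= ?inordK // => -[[]].
Qed.

(** The hypotheses collect what the three patterns share, so one argument refutes them all. *)
Lemma not_posdef_completable (R : realType) (P : {set 'I_5}) :
  inord 0 \in P -> inord 4 \in P -> inord 2 \notin P ->
  (inord 1 \in P) || (inord 3 \in P) -> ~ posdef_completable R P.
Proof.
move=> P0 P4 P2 P13 /(_ _ (pattern_counterexample R P)).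
case/(_ (partial_posdefmx_counterexample (R := R) P2)) => t [st pd].
have t0 : t (inord 0) = 1 by apply: st; rewrite /counterexample P0 eqxx.
have t4 : t (inord 4) = 1 by apply: st; rewrite /counterexample P4 eqxx orbT.
have := @posdefmx_hankel_form R t 1 0 (-1) pd; rewrite oner_neq0 t0 t4.
move=> /(_ isT) t2_lt1.
case/orP: P13 => Pk.
- have t1 : t (inord 1) = 2.
    by apply: st; rewrite /counterexample Pk -!val_eqE /= !inordK.
  have := @posdefmx_hankel_form R t 1 (-1) 0 pd; rewrite oner_neq0 t0 t1 t4.
  by move=> /(_ isT) t2_gt3; lra.
- have t3 : t (inord 3) = 2.
    by apply: st; rewrite /counterexample Pk -!val_eqE /= !inordK.
  (* Mirror image of the previous case under [k -> 4 - k]: the form is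
     [s_2 - 2 s_3 + s_4 = s_2 - 3]. *)
  have := @posdefmx_hankel_form R t 0 (-1) 1 pd.
  rewrite oner_neq0 !orbT t0 t3 t4.
  by move=> /(_ isT) t2_gt3; lra.
Qed.

Local Close Scope ring_scope.

Theorem theorem6p3 (R : realType) :
  [/\ ~ posdef_completable R [set k : 'I_5 | nat_of_ord k \in [:: 0; 1; 3; 4]],
      ~ posdef_completable R [set k : 'I_5 | nat_of_ord k \in [:: 0; 1; 4]] &
      ~ posdef_completable R [set k : 'I_5 | nat_of_ord k \in [:: 0; 3; 4]]].
Proof. by split; apply: not_posdef_completable; rewrite !inE !inordK. Qed.
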